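(* Let $K$ be a field, $S=K[x_1,\ldots,x_n]$, and let $I=P_{F_1}\cdots P_{F_r}\subset S$ be a transversal polymatroidal ideal with set of associated prime ideals $\operatorname{Ass}(I)=\{P_1,\ldots,P_l\}$ (with $P_1,\ldots,P_l$ pairwise distinct). For each $j=1,\ldots,l$ let $\mathcal T_j$ be a tree of $G_I$ with $P_j=P_{\mathcal T_j}$ that is maximal among the trees $\mathcal T$ of $G_I$ with $P_{\mathcal T}=P_j$, and let $a_j=|\mathcal V(\mathcal T_j)|$. Then for every $k\ge1$ $$I^k=\bigcap_{j=1}^l P_j^{ka_j}$$ is an irredundant primary decomposition of $I^k$.
   Context: For a non-empty subset $F\subset[n]=\{1,\ldots,n\}$, $P_F=(x_i : i\in F)$. A transversal polymatroidal ideal is an ideal of the form $I=P_{F_1}\cdots P_{F_r}$, where $r\ge1$ and $F_1,\ldots,F_r$ is a collection of non-empty, not necessarily distinct, subsets of $[n]$. $G_I$ is the graph with vertex set $\{1,\ldots,r\}$ in which, for $i\ne j$, $\{i,j\}$ is an edge if and only if $F_i\cap F_j\neq\emptyset$. A tree of $G_I$ is a non-empty subgraph of $G_I$ that is a tree; single vertices count as trees, and trees are ordered by inclusion. For a subgraph $\mathcal H$ of $G_I$ with vertex set $\mathcal V(\mathcal H)$, $P_{\mathcal H}=\sum_{i\in\mathcal V(\mathcal H)}P_{F_i}$. $\operatorname{Ass}(I)$ denotes the set of associated prime ideals of $S/I$; every $P\in\operatorname{Ass}(I)$ is of the form $P_{\mathcal T}$ for some tree $\mathcal T$ of $G_I$.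 *)

(* Defs.v *)
From mathcomp Require Import all_boot all_algebra ring_quotient.
From mathcomp Require Import boolp classical_sets.
From mathcomp Require Import mpoly.

Set Implicit Arguments.
Unset Strict Implicit.
Unset Printing Implicit Defensive.

Import GRing.Theory.

Local Open Scope ring_scope.
Local Open Scope classical_set_scope.

(* Ideals are Prop-valued subsets [set R], compared by [=]. *)
Section Ideals.
Variable R : comNzRingType.
Implicit Types (A I J P Q : set R) (f g : R).

Definition ideal_gen A : set R :=
  [set f | exists2 s : seq (R * R),
     (forall p, p \in s -> A p.2) & f = \sum_(p <- s) p.1 * p.2].

Definition ideal_add I J : set R := [set f + g | f in I & g in J].

Definition ideal_mul I J : set R := ideal_gen [set f * g | f in I & g in J].

Definition ideal_exp I (k : nat) : set R := iter k (ideal_mul I) setT.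

(* [idealr_closed] means "proper ideal": it includes 1 \notin _. *)
Definition prime_ideal P : Prop :=
  idealr_closed (mem P) /\ prime_idealr_closed (mem P).

Definition primary_ideal Q : Prop :=
  idealr_closed (mem Q) /\
  forall f g, Q (f * g) -> Q f \/ exists m : nat, Q (g ^+ m).

Definition radical I : set R := [set f | exists m : nat, I (f ^+ m)].

(* Ass(R/I): the primes that are annihilators of the class in R/I of some f. *)
Definition ass I : set (set R) :=
  [set P | prime_ideal P /\ exists f, P = [set g | I (g * f)]].

Definition irredundant_primary_decomposition (l : nat) (Q : 'I_l -> set R) I :
    Prop :=
  [/\ forall j, primary_ideal (Q j),
      I = \bigcap_(j in [set: 'I_l]) Q j,
      injective (fun j => radical (Q j)) &
      forall j, ~ (\bigcap_(i in [set i | i != j]) Q i `<=` Q j)].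

End Ideals.

Section Graphs.
Variable V : finType.

Record graph := Graph { vertices : {set V}; edges : {set {set V}} }.

Definition is_graph (H : graph) : Prop :=
  forall e, e \in edges H -> e \subset vertices H /\ #|e| = 2%N.

Definition subgraph (H G : graph) : Prop :=
  vertices H \subset vertices G /\ edges H \subset edges G.

Definition adj (H : graph) : rel V := fun u v => [set u; v]%SET \in edges H.

Definition connected (H : graph) : Prop :=
  {in vertices H &, forall u v, connect (adj H) u v}.

Definition acyclic (H : graph) : Prop :=
  forall c : seq V, (2 < size c)%N -> ~ ucycle (adj H) c.

Definition is_tree (T : graph) : Prop :=
  [/\ is_graph T, vertices T != finset.set0, connected T & acyclic T].

Definition tree_of (G T : graph) : Prop := subgraph T G /\ is_tree T.

End Graphs.

Section TransversalPolymatroidal.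
Variables (K : fieldType) (n r : nat).

Definition monomial_prime (F : {set 'I_n}) : set {mpoly K[n]} :=
  ideal_gen [set 'X_i | i in [set` F]].

Variable F : 'I_r -> {set 'I_n}.

Definition transversal_ideal : set {mpoly K[n]} :=
  \big[@ideal_mul {mpoly K[n]}/setT]_(i < r) monomial_prime (F i).

Definition intersection_graph : graph 'I_r :=
  Graph [set: 'I_r]%SET
    [set [set p.1; p.2]%SET | p : 'I_r * 'I_r &
       (p.1 != p.2) && (F p.1 :&: F p.2 != finset.set0)]%SET.

Definition subgraph_ideal (H : graph 'I_r) : set {mpoly K[n]} :=
  \big[@ideal_add {mpoly K[n]}/[set 0]]_(i in vertices H) monomial_prime (F i).

Definition maximal_tree_for (P : set {mpoly K[n]}) (T : graph 'I_r) : Prop :=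
  [/\ tree_of intersection_graph T, P = subgraph_ideal T &
      forall T', tree_of intersection_graph T' -> P = subgraph_ideal T' ->
        subgraph T T' -> T' = T].

End TransversalPolymatroidal.

Arguments transversal_ideal K {n r} F.

(* Main.v *)
(* For a set G of variables let a(G) be the number of i with F_i inside G. By
   Hall's theorem (with every F_i repeated k times), a monomial lies in I^k iff
   for every set A of indices its degree in the variables of the union of the
   F_i, i in A, is at least k |A|; splitting A into connected pieces, it is
   enough to require degree at least k a(G) in G whenever G is the union of a
   connected family. This writes I^k as the intersection of the P_G^(k a(G)).
   For such a G, pick a spanning tree of {i | F_i inside G}, one common variable
   for each of its edges, and add high powers of the variables outside G: the
   resulting monomial w has G-degree a(G) - 1 and satisfies all the other degree
   conditions. Hence I : w = P_G, so that every such P_G is associated to I, and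
   w^k shows that P_G^(k a(G)) cannot be omitted. A maximal tree for P_G has
   vertex set {i | F_i inside G}, as otherwise a leaf could be added to it. *)
From HB Require Import structures.
Require Import Defs.
From mathcomp Require Import all_boot all_algebra ring_quotient zify ring.
From mathcomp Require Import boolp classical_sets.
From mathcomp Require Import mpoly.

Set Implicit Arguments.
Unset Strict Implicit.
Unset Printing Implicit Defensive.

Import GRing.Theory.

Local Open Scope ring_scope.
Local Open Scope classical_set_scope.

(** * Degree of a monomial in a set of variables *)

Section Weights.
Variable n : nat.
Implicit Types (G H : {set 'I_n}) (m u : 'X_{1..n}).

Definition wt G m : nat := (\sum_(x in G) m x)%N.

Lemma wt0 G : wt G 0%MM = 0%N.
Proof. by rewrite /wt big1 // => x _; rewrite mnm0E. Qed.

Lemma wtD G : {morph wt G : m u / (m + u)%MM >-> (m + u)%N}.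
Proof.
by move=> m u; rewrite /wt -big_split; apply: eq_bigr => x _; rewrite mnmDE.
Qed.

(** This makes the homogeneous components [pihomog] available for the grading by [G]-degree. *)
HB.instance Definition _ G := isMeasure.Build n (wt G) (wt0 G) (@wtD G).

Lemma wtMn G m k : wt G (m *+ k)%MM = (k * wt G m)%N.
Proof.
by rewrite /wt big_distrr; apply: eq_bigr => x _; rewrite mulmnE mulnC.
Qed.

Lemma wtU G x : wt G U_(x)%MM = (x \in G).
Proof.
rewrite /wt; have [xG|xG] := boolP (x \in G).
  rewrite (bigD1 x) //= mnm1E eqxx big1 // => y /andP[_ /negPf yx].
  by rewrite mnm1E eq_sym yx.
rewrite big1 // => y yG; rewrite mnm1E; case: eqP => // xy.
by rewrite xy yG in xG.
Qed.

Lemma leq_wt G m u : (m <= u)%MM -> (wt G m <= wt G u)%N.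
Proof. by move=> /mnm_lepP mu; apply: leq_sum. Qed.

Lemma wtS G H m : G \subset H -> (wt G m <= wt H m)%N.
Proof.
move=> GH; rewrite /wt (big_setID G (A := H)) /= (finset.setIidPr GH).
exact: leq_addr.
Qed.

Lemma wt_setU_I G H m :
  (wt (G :|: H) m + wt (G :&: H) m = wt G m + wt H m)%N.
Proof.
rewrite /wt (big_setID G (A := G :|: H)) /=.
rewrite (finset.setIidPr (finset.subsetUl G H)).
rewrite [in RHS](big_setID G (A := H)) /= finset.setDUl finset.setDv.
by rewrite finset.set0U [(H :&: G)%SET]finset.setIC; lia.
Qed.

Lemma wt_setU_disjoint G H m :
  G :&: H = finset.set0 -> wt (G :|: H) m = (wt G m + wt H m)%N.
Proof.
move=> GH; rewrite -wt_setU_I GH.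
by rewrite [wt finset.set0 _]big_set0 addn0.
Qed.

Lemma wt_gt0P G m : reflect (exists2 x, x \in G & (0 < m x)%N) (0 < wt G m)%N.
Proof.
apply: (iffP idP) => [|[x xG mx]]; last by rewrite /wt (bigD1 x) //= ltn_addr.
rewrite lt0n sum_nat_eq0 => /forall_inPn[x xG]; rewrite -lt0n => mx.
by exists x.
Qed.

Lemma lepmD m u m' u' :
  (m <= m')%MM -> (u <= u')%MM -> (m + u <= m' + u')%MM.
Proof.
move=> /mnm_lepP mm /mnm_lepP uu; apply/mnm_lepP => i; rewrite !mnmDE.
exact: leq_add.
Qed.

Lemma le0m m : (0%MM <= m)%MM.
Proof. by apply/mnm_lepP => x; rewrite mnm0E. Qed.

Lemma leU x m : (U_(x) <= m)%MM = (0 < m x)%N.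
Proof.
apply/mnm_lepP/idP => [/(_ x)|mx i]; first by rewrite mnm1E eqxx.
by rewrite mnm1E; case: eqP => // <-.
Qed.

End Weights.

(** * Monomial ideals: sums, products and powers *)

Section MonomialIdeals.
Variables (K : fieldType) (n : nat).
Implicit Types (f g : {mpoly K[n]}) (m u : 'X_{1..n}) (M N : set 'X_{1..n}).

(* The ideal generated by the monomials with exponents in [M], described by
   the monomials of its elements. *)
Definition monideal M : set {mpoly K[n]} :=
  [set f | forall m, m \in msupp f -> exists2 u, M u & (u <= m)%MM].

Definition sumset M N : set 'X_{1..n} := [set (m + u)%MM | m in M & u in N].

Lemma monideal0 M : monideal M 0.
Proof. by move=> m; rewrite msupp0. Qed.

Lemma monidealD M f g : monideal M f -> monideal M g -> monideal M (f + g).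
Proof.
by move=> Mf Mg m /msuppD_le; rewrite mem_cat => /orP[/Mf|/Mg].
Qed.

Lemma monidealMl M f g : monideal M g -> monideal M (f * g).
Proof.
move=> Mg m /msuppM_le /allpairsP[[a b] /= [_ /Mg[u Mu ub] ->]].
by exists u => //; apply: lepm_trans ub (lem_addl _ _).
Qed.

Lemma monidealX M m : monideal M 'X_[m] <-> exists2 u, M u & (u <= m)%MM.
Proof.
split=> [|Mm v]; first by apply; rewrite msuppX mem_head.
by rewrite msuppX mem_seq1 => /eqP->.
Qed.

Lemma ideal_gen_monideal (A : set {mpoly K[n]}) M :
    A `<=` monideal M -> (forall u, M u -> A 'X_[u]) ->
  ideal_gen A = monideal M.
Proof.
move=> AM MA; apply/seteqP; split=> f.
  case=> s As ->; rewrite big_seq; apply: big_ind => [|? ?|p /As /AM].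
  - exact: monideal0.
  - exact: monidealD.
  - exact: monidealMl.
move=> Mf.
(* [h m] is a generator dividing [m]; off the support of [f] its value is arbitrary. *)
have /choice[h hP] m : exists u, m \in msupp f -> M u /\ (u <= m)%MM.
  by case: (boolP (m \in msupp f)) => [/Mf[u]|_]; [exists u | exists m].
exists [seq (f@_m *: 'X_[m - h m], 'X_[h m]) | m <- msupp f].
  by move=> _ /mapP[m /hP[Mh _] ->]; apply: MA.
rewrite big_map [LHS]mpolyE; apply: eq_big_seq => m /hP[_ hm] /=.
by rewrite -scalerAl -mpolyXD submK.
Qed.

Lemma ideal_mul_monideal M N :
  ideal_mul (monideal M) (monideal N) = monideal (sumset M N).
Proof.
apply: ideal_gen_monideal => [_ [f Mf [g Ng <-]] m|_ [m Mm [u Nu <-]]].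
  move=> /msuppM_le /allpairsP[[a b] /= [/Mf[u Mu ua] /Ng[v Nv vb] ->]].
  by exists (u + v)%MM; [exists u => //; exists v | apply: lepmD].
exists 'X_[m]; first by apply/monidealX; exists m => //; exact: lepm_refl.
exists 'X_[u]; last by rewrite mpolyXD.
by apply/monidealX; exists u => //; exact: lepm_refl.
Qed.

Lemma monideal_setT : monideal [set 0%MM] = setT.
Proof.
by apply/seteqP; split=> // f _ m _; exists 0%MM => //; exact: le0m.
Qed.

Lemma ideal_exp_monideal M k :
  ideal_exp (monideal M) k = monideal (iter k (sumset M) [set 0%MM]).
Proof.
elim: k => [|k IHk]; first by rewrite monideal_setT.
by rewrite -[LHS]/(ideal_mul _ (ideal_exp _ k)) IHk ideal_mul_monideal.
Qed.

Lemma ideal_exp1_monideal M : ideal_exp (monideal M) 1 = monideal M.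
Proof.
rewrite ideal_exp_monideal; congr monideal; apply/seteqP.
split=> [_ [m Mm [_ -> <-]]|m Mm]; first by rewrite addm0.
by exists m => //; exists 0%MM => //; rewrite addm0.
Qed.

Lemma ideal_add_monideal M N :
  ideal_add (monideal M) (monideal N) = monideal (M `|` N).
Proof.
apply/seteqP; split=> [_ [f Mf [g Ng <-]]|f MNf].
  move=> m /msuppD_le; rewrite mem_cat => /orP[/Mf[u]|/Ng[u]]; exists u => //.
    by left.
  by right.
(* The terms of [f] are sorted into those lying in [monideal M] and the rest, which must lie in
   [monideal N]. *)
pose inM m := `[< exists2 u, M u & (u <= m)%MM >].
have part (p : pred 'X_{1..n}) m :
    m \in msupp (\sum_(v <- msupp f | p v) f@_v *: 'X_[v]) ->
    m \in msupp f /\ p m.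
  move=> /msupp_sum_le /flattenP[_ /mapP[v + ->]].
  by rewrite mem_filter => /andP[pv vf] /msuppZ_le /mem_msuppXP <-.
exists (\sum_(v <- msupp f | inM v) f@_v *: 'X_[v]).
  by move=> m /part[_ /asboolP].
exists (\sum_(v <- msupp f | ~~ inM v) f@_v *: 'X_[v]).
  move=> m /part[/MNf[u [Mu|Nu] um] /asboolPn nM]; last by exists u.
  by case: nM; exists u.
by rewrite [RHS]mpolyE [RHS](bigID inM).
Qed.

Lemma monideal_set0 : monideal set0 = [set 0].
Proof.
apply/seteqP; split=> [f Mf|_ ->]; last exact: monideal0.
apply: msuppnil0; case E: (msupp f) => [//|m s].
by have [] : exists2 u, set0 u & (u <= m)%MM by apply: Mf; rewrite E mem_head.
Qed.

Definition vars (G : {set 'I_n}) : set 'X_{1..n} := [set U_(x)%MM | x in [set`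
  G]].

Lemma monomial_primeE G : @monomial_prime K n G = monideal (vars G).
Proof.
apply: ideal_gen_monideal => [_ [x Gx <-]|_ [x Gx <-]]; last by exists x.
by apply/monidealX; exists U_(x)%MM; [exists x | exact: lepm_refl].
Qed.

(** Variables of [G] are peeled off one at a time: each lowers the [G]-degree by one, and a positive
    [G]-degree guarantees that one is left. *)
Lemma vars_exp_mem G k m :
  (exists2 u, iter k (sumset (vars G)) [set 0%MM] u & (u <= m)%MM) <->
  (k <= wt G m)%N.
Proof.
elim: k m => [|k IHk] m /=.
  by split=> // _; exists 0%MM => //; exact: le0m.
split=> [[_ [_ [x Gx <-] [u Iu <-]] xum]|km].
  have: (U_(x) <= m)%MM by apply: lepm_trans xum; exact: lem_addr.
  move=> /[dup] xm /submK mE; rewrite -mE wtD wtU [x \in G]Gx addn1 ltnS.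
  apply/IHk; exists u => //.
  by apply/mnm_lepP => i; move/mnm_lepP: xum => /(_ i); rewrite !mnmDE mnmBE;
    lia.
have /wt_gt0P[x Gx mx] : (0 < wt G m)%N by apply: leq_trans km.
have /submK mE : (U_(x) <= m)%MM by rewrite leU.
move: km; rewrite -mE wtD wtU Gx addn1 ltnS => /IHk[u Iu um].
exists (U_(x) + u)%MM; first by exists U_(x)%MM; [exists x | exists u].
by rewrite addmC; apply: lepmD um (lepm_refl _).
Qed.

Lemma monomial_prime_exp G k :
  ideal_exp (@monomial_prime K n G) k =
  [set f | forall m, m \in msupp f -> (k <= wt G m)%N].
Proof.
rewrite monomial_primeE ideal_exp_monideal.
by apply/seteqP; split=> f Gf m /Gf /vars_exp_mem.
Qed.

Lemma monomial_primeP G f :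
  @monomial_prime K n G f <-> forall m, m \in msupp f -> (0 < wt G m)%N.
Proof.
have := monomial_prime_exp G 1;
  rewrite monomial_primeE ideal_exp1_monideal => ->.
by [].
Qed.

Lemma monomial_prime_bigcup (I : finType) (F : I -> {set 'I_n}) (A : {set I}) :
  \big[@ideal_add {mpoly K[n]}/[set 0]]_(i in A) @monomial_prime K n (F i) =
  @monomial_prime K n (\bigcup_(i in A) F i)%SET.
Proof.
rewrite (big_morph (@monomial_prime K n) (op1 := @ideal_add _) (id1 := [set
  0])) //.
  move=> G H; rewrite !monomial_primeE ideal_add_monideal; congr monideal.
  apply/seteqP; split=> [_ [x + <-]|_ [[x + <-]|[x + <-]]] /=.
  - by move=> /finset.setUP[xG|xH]; [left|right]; exists x.
  - by move=> xG; exists x => //; apply/finset.setUP; left.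
  - by move=> xH; exists x => //; apply/finset.setUP; right.
rewrite monomial_primeE -monideal_set0; congr monideal.
by apply/seteqP; split=> // u [x]; rewrite /= finset.in_set0.
Qed.

Lemma monomial_prime_inj : injective (@monomial_prime K n).
Proof.
move=> G H GH; apply/finset.setP => x.
have inP A : reflect (@monomial_prime K n A 'X_x) (x \in A).
  apply: (iffP idP) => [xA|/monomial_primeP/(_ U_(x)%MM)].
    by apply/monomial_primeP => m; rewrite msuppX mem_seq1 => /eqP->;
      rewrite wtU xA.
  by rewrite msuppX mem_head wtU => /(_ isT); case: (x \in A).
by apply/inP/inP; rewrite GH.
Qed.

End MonomialIdeals.

(** * Order along a set of variables; powers of monomial primes are primary *)

Section Valuation.
Variables (K : fieldType) (n : nat) (G : {set 'I_n}).
Implicit Types (f g : {mpoly K[n]}) (m u : 'X_{1..n}).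

Lemma mcoeff_pihomog d f m :
  (pihomog (wt G) d f)@_m = if wt G m == d then f@_m else 0.
Proof.
rewrite pihomogE raddf_sum /=.
case: (boolP (m \in msupp f)) => [mf|mf]; last first.
  rewrite (memN_msupp_eq0 mf) if_same big_seq_cond big1 // => u /andP[uf _].
  have /negPf um : u != m by apply: contraNneq mf => <-.
  by rewrite mcoeffZ mcoeffX um mulr0.
rewrite big_mkcond (bigD1_seq m) ?msupp_uniq //= big1 ?addr0 => [|u um].
  by case: ifP => // _; rewrite mcoeffZ mcoeffX eqxx mulr1.
by case: ifP => // _; rewrite mcoeffZ mcoeffX (negPf um) mulr0.
Qed.

(** The order of [f] along [G] is at most [a]. It fails for [f = 0], whose order is infinite. *)
Definition vle a f := exists2 m, m \in msupp f & (wt G m <= a)%N.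

(* Otherwise the lowest [G]-homogeneous part of the product, which is the
   product of the lowest parts, would vanish. *)
Lemma vleM a b f g : vle a f -> vle b g -> vle (a + b) (f * g).
Proof.
have low c h : vle c h -> exists2 d, (d <= c)%N &
    [/\ pihomog (wt G) d h != 0, forall m, m \in msupp h -> (d <= wt G m)%N &
     forall m, m \in msupp (h - pihomog (wt G) d h) -> (d < wt G m)%N].
  case=> m0 m0h m0c.
  have exd : exists d, has (fun m => wt G m == d) (msupp h).
    by exists (wt G m0); apply/hasP; exists m0.
  case: (ex_minnP exd) => d /hasP[m1 m1h /eqP m1d] dmin.
  have dle m : m \in msupp h -> (d <= wt G m)%N.
    by move=> mh; apply: dmin; apply/hasP; exists m.
  exists d; first exact: leq_trans (dle _ m0h) m0c.
  split=> // [|m].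
    apply/eqP => /(congr1 (mcoeff m1)); rewrite mcoeff_pihomog m1d eqxx mcoeff0.
    by move/eqP; rewrite mcoeff_eq0 m1h.
  rewrite mcoeff_msupp mcoeffB mcoeff_pihomog.
  case: ifP => [_|/negbT md]; first by rewrite subrr eqxx.
  by rewrite subr0 -mcoeff_msupp => mh; rewrite ltn_neqAle eq_sym md dle.
move=> /low[a' aa' [f0 _ fP]] /low[b' bb' [g0 gle gP]].
set f' := pihomog _ a' f in f0 fP; set g' := pihomog _ b' g in g0 gP.
have fgh : f' * g' \is (a' + b').-homog for (wt G).
  by apply: dhomogM; exact: pihomogP.
have fg0 : f' * g' != 0 by rewrite mulf_neq0.
have lead := mlead_supp fg0; set m := mlead _ in lead.
have wm : wt G m = (a' + b')%N by move/dhomogP: fgh; apply.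
exists m; last by rewrite wm leq_add.
(* Both summands after [f' * g'] have only monomials of [G]-degree above [a' + b'], so they cannot
   cancel [m]. *)
have -> : f * g = f' * g' + (f' * (g - g') + (f - f') * g) by ring.
have gap (p q : {mpoly K[n]}) c d : (forall u, u \in msupp p -> c <= wt G u)%N
  ->
    (forall u, u \in msupp q -> d <= wt G u)%N -> (a' + b' < c + d)%N ->
    (p * q)@_m = 0.
  move=> pc qd cd; apply: memN_msupp_eq0; apply/negP.
  move=> /msuppM_le /allpairsP[[u v] /= [/pc cu /qd dv E]].
  by move: wm; rewrite E wtD; lia.
rewrite mcoeff_msupp !mcoeffD (gap f' (g - g') a' b'.+1) //; last first.
- by rewrite addnS.
- by move=> u /(dhomog_mf (pihomogP _ _ _)) ->.
by rewrite (gap (f - f') g a'.+1 b') // !addr0 -mcoeff_msupp.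
Qed.
Lemma vle0X f k : vle 0 f -> vle 0 (f ^+ k).
Proof.
move=> f0; elim: k => [|k IHk]; last by rewrite exprS; exact: (@vleM 0 0).
by exists 0%MM; rewrite ?wt0 // expr0 msupp1 mem_head.
Qed.

Let PG := @monomial_prime K n G.

Lemma vle0P f : ~ PG f <-> vle 0 f.
Proof.
split=> [nGf|[m mf m0] /monomial_primeP/(_ m mf)]; last by rewrite ltnNge m0.
apply: contrapT => nv; apply: nGf; apply/monomial_primeP => m mf.
by rewrite lt0n; apply/eqP => m0; apply: nv; exists m; rewrite ?m0.
Qed.

Lemma monomial_prime_exp_closed k :
  (0 < k)%N -> idealr_closed (mem (ideal_exp PG k)).
Proof.
move=> k0; have -> : mem (ideal_exp PG k) =
    mem (monideal (iter k (sumset (vars G)) [set 0%MM])).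
  by rewrite /PG monomial_primeE ideal_exp_monideal.
split.
- by apply/mem_set; exact: monideal0.
- rewrite notin_setE -ideal_exp_monideal -monomial_primeE monomial_prime_exp.
  by move=> /(_ 0%MM); rewrite msupp1 mem_head wt0 leqn0 => /(_ isT)/eqP k00;
    rewrite k00 in k0.
move=> a f g /set_mem Gf /set_mem Gg; apply/mem_set.
by apply: monidealD => //; exact: monidealMl.
Qed.

Lemma ideal_exp1_monomial_prime : ideal_exp PG 1 = PG.
Proof.
by rewrite /PG monomial_primeE ideal_exp1_monideal.
Qed.

Lemma monomial_prime_prime : prime_ideal PG.
Proof.
split; first by rewrite -ideal_exp1_monomial_prime;
  exact: monomial_prime_exp_closed.
move=> f g /set_mem Gfg; apply/orP; apply: contrapT => nfg.
have /vle0P : vle 0 (f * g); last exact.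
by apply: (@vleM 0 0); apply/vle0P => h; apply: nfg; [left|right];
  exact: mem_set.
Qed.

Lemma monomial_prime_exp_pow f k : PG f -> ideal_exp PG k (f ^+ k).
Proof.
move=> Gf; rewrite monomial_prime_exp; elim: k => [//|k IHk] m.
rewrite exprS => /msuppM_le /allpairsP[[a b] /= [+ /IHk kb ->]].
by move=> /(proj1 (monomial_primeP _ _) Gf) a0; rewrite wtD -add1n leq_add.
Qed.

(** A factor [g] outside [PG] has order 0, so by [vleM] the product [f * g] has order at most that
    of [f]; a factor [g] in [PG] has its [k]-th power in the ideal. *)
Lemma monomial_prime_exp_primary k : (0 < k)%N -> primary_ideal (ideal_exp PG
  k).
Proof.
move=> k0; split; first exact: monomial_prime_exp_closed.
move=> f g Gfg; have [Gg|/vle0P vg] := pselect (PG g).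
  by right; exists k; exact: monomial_prime_exp_pow.
left; move: Gfg; rewrite monomial_prime_exp => Gfg m mf.
rewrite leqNgt; apply/negP => mk.
have [u /Gfg ku] : vle (wt G m + 0) (f * g) by apply: vleM => //; exists m.
by move=> um; move: (leq_trans ku um); rewrite addn0 leqNgt mk.
Qed.

Lemma radical_monomial_prime_exp k : (0 < k)%N -> radical (ideal_exp PG k) = PG.
Proof.
move=> k0; apply/seteqP; split=> [f [d]|f Gf]; last first.
  by exists k; exact: monomial_prime_exp_pow.
rewrite monomial_prime_exp => Gfd; apply: contrapT => /vle0P/(vle0X d)[m /Gfd].
by move=> /leq_trans/[apply]; rewrite leqNgt k0.
Qed.

End Valuation.

(** * Hall's theorem and the monomials of the powers of the ideal *)

Section Hall.
Variables (n : nat) (I : finType) (F : I -> {set 'I_n}).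
Implicit Types (A B : {set I}) (d : I -> nat) (m u : 'X_{1..n}).

Definition nbhd A : {set 'I_n} := (\bigcup_(i in A) F i)%SET.

Lemma nbhdU A B : nbhd (A :|: B) = (nbhd A :|: nbhd B)%SET.
Proof. exact: finset.bigcup_setU. Qed.

Lemma nbhd1 i : nbhd [set i] = F i.
Proof. exact: big_set1. Qed.

Lemma nbhdS A B : A \subset B -> nbhd A \subset nbhd B.
Proof. by move=> /finset.setUidPr <-; rewrite nbhdU finset.subsetUl. Qed.

Lemma sub_nbhd i A : i \in A -> F i \subset nbhd A.
Proof. by move=> iA; apply: finset.bigcup_sup. Qed.

(** Hall's condition when index [i] demands [d i] variables from [F i] and the variable [x] is in
    stock [m x] times. *)
Definition hall d m := forall A, (\sum_(i in A) d i <= wt (nbhd A) m)%N.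

(* Sets satisfying the Hall condition with equality are closed under union, so
   those avoiding [i] have a largest member [B]; any variable of [m] in
   [F i] outside [nbhd B] can be given to [i]. *)
Lemma hall_step d m i : hall d m -> (0 < d i)%N ->
  exists x, [/\ x \in F i, (U_(x) <= m)%MM &
    hall (fun j => d j - (j == i))%N (m - U_(x))%MM].
Proof.
move=> dm di; pose s A := (\sum_(j in A) d j)%N.
pose tight A := (wt (nbhd A) m == s A) && (i \notin A).
have sU A B : (s (A :|: B) + s (A :&: B) = s A + s B)%N.
  rewrite /s (big_setID A (A := (A :|: B)%SET)) /=.
  rewrite (finset.setIidPr (finset.subsetUl A B)).
  rewrite [in RHS](big_setID A (A := B)) /= finset.setDUl finset.setDv.
  by rewrite finset.set0U [(B :&: A)%SET]finset.setIC; lia.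
have tight0 : tight finset.set0.
  by rewrite /tight finset.inE andbT /s /nbhd !big_set0 /wt big_set0.
have tightU A B : tight A -> tight B -> tight (A :|: B)%SET.
  move=> /andP[/eqP tA iA] /andP[/eqP tB iB].
  rewrite /tight finset.in_setU negb_or iA iB andbT.
  have := wt_setU_I (nbhd A) (nbhd B) m; rewrite -nbhdU tA tB -sU => E.
  have := dm (A :|: B)%SET; have := dm (A :&: B)%SET; rewrite -!/(s _).
  have : (wt (nbhd (A :&: B)) m <= wt (nbhd A :&: nbhd B) m)%N.
    apply: wtS; rewrite finset.subsetI !nbhdS //.
      exact: finset.subsetIr.
    exact: finset.subsetIl.
  by move=> *; apply/eqP; lia.
case: (arg_maxnP (fun A : {set I} => #|A|) tight0) => B tB Bmax.
have tightB A : tight A -> A \subset B.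
  move=> tA; have /Bmax cAB := tightU _ _ tA tB.
  suff <- : (A :|: B)%SET = B by exact: finset.subsetUl.
  by apply/esym/eqP; rewrite eqEcard finset.subsetUr.
have /andP[/eqP wB iB] := tB.
(* Subtracting the equality for [B] from the inequality for [i |: B] leaves at least [d i] here. *)
have : (0 < wt (F i :\: nbhd B) m)%N.
  have := dm (i |: B)%SET; rewrite big_setU1 //= nbhdU nbhd1.
  rewrite /wt (big_setID (nbhd B)) /=.
  rewrite finset.setUC (finset.setIidPr (finset.subsetUl _ _)).
  rewrite finset.setDUl finset.setDv finset.set0U.
  by move: wB; rewrite /wt /s => ->; rewrite addnC leq_add2l; exact: leq_trans.
case/wt_gt0P => x; rewrite finset.in_setD => /andP[xB xF] mx.
have Um : (U_(x) <= m)%MM by rewrite leU.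
exists x; split=> // A; have := congr1 (wt (nbhd A)) (submK Um).
rewrite wtD wtU => wA; have := dm A; rewrite -/(s A).
have [iA|iA] := boolP (i \in A).
  have xA : x \in nbhd A by apply: (fintype.subsetP (sub_nbhd iA)).
  rewrite (bigD1 i) //= eqxx (eq_bigr d) => [|j /andP[_ /negPf->]]; last first.
    by rewrite subn0.
  rewrite /s (bigD1 i) //=.
  by move: wA; rewrite xA; lia.
rewrite (eq_bigr d) -/(s A) => [|j jA]; last first.
  by case: eqP jA iA => [->->|]; rewrite ?subn0.
have [xA|xA] := boolP (x \in nbhd A); last by move: wA; rewrite (negPf xA); lia.
(* Losing [x] costs [A] one unit, so its inequality has to be strict; were [A] tight, it would lie
   in [B] and [x] in [nbhd B]. *)
move=> sA; suff : s A != wt (nbhd A) m by move: wA; rewrite xA; lia.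
apply/eqP => tA; have : tight A by rewrite /tight tA eqxx.
by move=> /tightB/nbhdS/fintype.subsetP/(_ x xA); rewrite (negPf xB).
Qed.

Definition transversals (s : seq I) : set 'X_{1..n} :=
  \big[@sumset n/[set 0%MM]]_(i <- s) vars (F i).

(** The indices of [s] are served one after the other by [hall_step]; without repetitions, serving
    one leaves the demands of the others positive. *)
Lemma hall_transversal (s : seq I) d m :
    uniq s -> hall d m -> (forall i, i \in s -> (0 < d i)%N) ->
  exists u, [/\ transversals s u, (u <= m)%MM &
    hall (fun j => d j - (j \in s))%N (m - u)%MM].
Proof.
elim: s d m => [|i s IHs] d m /=.
  move=> _ dm _; exists 0%MM; split; [|exact: le0m|].
    by rewrite /transversals big_nil.
  rewrite subm0 => A; apply: leq_trans (dm A).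
  by apply: leq_sum => j _; exact: leq_subr.
move=> /andP[is_s us] dm d0;
  have /(hall_step dm)[x [xi xm]] := d0 i (mem_head _ _).
move=> /(IHs _ _ us)[j js|u [su um dmu]].
  have /negPf-> : j != i by apply: contraNneq is_s => <-.
  by rewrite subn0 d0 // inE js orbT.
exists (U_(x) + u)%MM; split.
- rewrite /transversals big_cons; exists U_(x)%MM; first by exists x.
  by exists u.
- by rewrite -(submK xm) addmC lepmD ?lepm_refl.
rewrite -submDA => A; apply: leq_trans (dmu A); apply: leq_sum => j _.
rewrite in_cons; case: eqP is_s => [->/negPf->|_ _] /=; first by rewrite subn0.
by rewrite subn0.
Qed.

(** The easy half of Hall's theorem: each index of [s] lying in [A] contributes its own variable of
    [nbhd A]. *)
Lemma transversals_wt (s : seq I) u A :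
  transversals s u -> (count (mem A) s <= wt (nbhd A) u)%N.
Proof.
rewrite /transversals; elim: s u => [|i s IHs] u; first by [].
rewrite big_cons /= => -[_ [x xi <-] [v /IHs sv <-]];
  rewrite wtD wtU leq_add //.
by case: (boolP (i \in A)) => // /sub_nbhd/fintype.subsetP/(_ x xi) ->.
Qed.

(** For the converse all demands start equal to the number of factors; removing one full transversal
    lowers each of them by one. *)
Lemma transversals_exp k m :
  (exists2 u, iter k (sumset (transversals (index_enum I))) [set 0%MM] u &
     (u <= m)%MM) <->
  forall A, (k * #|A| <= wt (nbhd A) m)%N.
Proof.
split=> [[u + um] A|].
  suff : iter k (sumset (transversals (index_enum I))) [set 0%MM] u ->
         (k * #|A| <= wt (nbhd A) u)%N.
    by move=> /[apply] /leq_trans; apply; exact: leq_wt.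
  elim: k u {um} => [//|k IHk] _ /= [u /(transversals_wt A) Au [v /IHk Av <-]].
  by rewrite wtD mulSn leq_add // -sum1_card sum1_count.
elim: k m => [|k IHk] m km; first by exists 0%MM => //; exact: le0m.
have hm : hall (fun=> k.+1) m by move=> A; rewrite sum_nat_const mulnC.
have [//|u [uI um hu]] := hall_transversal (index_enum_uniq I) hm.
have /IHk[v kv vm] A : (k * #|A| <= wt (nbhd A) (m - u))%N.
  apply: leq_trans (hu A); rewrite mulnC -sum_nat_const; apply: leq_sum => i _.
  by rewrite mem_index_enum subn1.
exists (u + v)%MM; first by exists u => //; exists v.
by rewrite -(submK um) addmC lepmD ?lepm_refl.
Qed.

End Hall.

Lemma transversal_ideal_monideal (K : fieldType) (n r : nat)
    (F : 'I_r -> {set 'I_n}) :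
  transversal_ideal K F = monideal (transversals F (index_enum 'I_r)).
Proof.
rewrite /transversal_ideal /transversals.
rewrite [RHS](big_morph (@monideal K n) (op1 := @ideal_mul _) (id1 := setT)).
- by apply: eq_bigr => i _; exact: monomial_primeE.
- by move=> M N; rewrite ideal_mul_monideal.
- exact: monideal_setT.
Qed.

Lemma transversal_ideal_exp (K : fieldType) (n r : nat)
    (F : 'I_r -> {set 'I_n}) k :
  ideal_exp (transversal_ideal K F) k =
  [set f | forall m, m \in msupp f ->
     forall A : {set 'I_r}, (k * #|A| <= wt (nbhd F A) m)%N].
Proof.
rewrite transversal_ideal_monideal ideal_exp_monideal.
by apply/seteqP; split=> f If m /If /transversals_exp.
Qed.

Lemma transversal_idealP (K : fieldType) (n r : nat) (F : 'I_r -> {set 'I_n})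
    (f : {mpoly K[n]}) :
  transversal_ideal K F f <->
  forall m, m \in msupp f -> forall A : {set 'I_r}, (#|A| <= wt (nbhd F A) m)%N.
Proof.
rewrite transversal_ideal_monideal -ideal_exp1_monideal
  -transversal_ideal_monideal transversal_ideal_exp.
by split=> If m /If mA A; have := mA A; rewrite mul1n.
Qed.

(** * Connected families of sets *)

Section Grown.
Variables (n : nat) (I : finType) (F : I -> {set 'I_n}).
Implicit Types (A B C : {set I}) (m w : 'X_{1..n}).

(* The vertex sets of the trees of the intersection graph of [F]. *)
Inductive grown : {set I} -> Prop :=
| grown1 i : grown [set i]
| grownU1 i A : grown A -> i \notin A -> (F i :&: nbhd F A)%SET != finset.set0
  ->
    grown (i |: A)%SET.

(** A saturated set is determined by its neighbourhood, as the set of all [i] with [F i] inside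
    it. *)
Definition saturated A := forall i, F i \subset nbhd F A -> i \in A.

(* The exponent of the product of one variable of [F i :&: F j] for each edge
   [{i, j}] of a spanning tree of [A]. *)
Lemma grown_edges A : grown A -> exists w, [/\ forall G, (wt G w < #|A|)%N,
  (#|A| <= (wt (nbhd F A) w).+1)%N &
  forall B, B \proper A -> (#|B| <= wt (nbhd F B) w)%N].
Proof.
elim=> [i|i {}A gA [w [wG wA wB]] iA /set0Pn[x]].
  exists 0%MM; split=> [G||B]; rewrite ?wt0 ?cards1 //.
  by rewrite finset.properEneq finset.subset1 => /andP[/negPf-> /= /eqP->];
    rewrite cards0.
(* The new vertex [i] is joined to [A] by one edge, which contributes the common variable [x]. *)
rewrite finset.in_setI => /andP[xi xA]; exists (w + U_(x))%MM.
have sAiA : A \subset (i |: A)%SET by exact: finset.subsetUr.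
have NAi := nbhdS F sAiA.
split=> [G||B /andP[sB pB]]; rewrite ?cardsU1 ?iA wtD wtU.
- by have := wG G; case: (x \in G); lia.
- by rewrite (fintype.subsetP NAi _ xA); have := wtS w NAi; lia.
(* If [B] contains [A], then [B = A] and [x] supplies the one unit that [w] lacks. Otherwise
   induction covers [A :&: B], and [x] pays for [i] if [i] is in [B]. *)
have [AB|nAB] := boolP (A \subset B).
  have iB : i \notin B.
    by apply: contraNN pB => iB; rewrite finset.subUset finset.sub1set iB.
  have BA : B \subset A.
    apply/fintype.subsetP => j jB; have := fintype.subsetP sB j jB.
    rewrite finset.in_setU1 => /predU1P[ji|//]; by rewrite ji in jB;
      rewrite jB in iB.
  rewrite (fintype.subsetP (nbhdS F AB) _ xA) addn1.
  by apply: leq_trans (subset_leq_card BA) (leq_trans wA _);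
    rewrite ltnS wtS ?nbhdS.
rewrite -(cardsID A B) leq_add //.
  apply: leq_trans (wB _ _) (wtS _ (nbhdS _ (finset.subsetIl _ _))).
  by rewrite properE finset.subsetIr finset.subsetI negb_and nAB.
have BAi : B :\: A \subset [set i]%SET.
  by rewrite finset.subDset finset.setUC.
have [iB|iB] := boolP (i \in B).
  rewrite (fintype.subsetP (sub_nbhd F iB) _ xi).
  by apply: leq_trans (subset_leq_card BAi) _; rewrite cards1.
rewrite (_ : (B :\: A)%SET = finset.set0) ?cards0 //.
apply/eqP; move: BAi; rewrite finset.subset1 => /predU1P[BAi|//].
by have := finset.set11 i; rewrite -BAi finset.in_setD (negPf iB) andbF.
Qed.

Lemma grown_witness A : grown A -> saturated A ->
  exists2 w, (wt (nbhd F A) w).+1 = #|A| &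
    forall B, nbhd F B <> nbhd F A -> (#|B| <= wt (nbhd F B) w)%N.
Proof.
move=> /grown_edges[w [wG wA wB]] sA.
(* The exponent [#|I|] bounds every [#|B|], so a single variable outside [nbhd F A] settles the
   inequality for [B]. *)
pose v : 'X_{1..n} := [multinom (if x \in nbhd F A then w x else #|I|) | x < n].
have vw (G : {set 'I_n}) : G \subset nbhd F A -> wt G v = wt G w.
  by move=> GA; apply: eq_bigr => x /(fintype.subsetP GA) xA; rewrite mnmE xA.
exists v; first by rewrite vw //; apply/eqP; rewrite eqn_leq wA wG.
(* When the neighbourhood of [B] lies inside that of [A], saturation gives [B \subset A], properly
   since the neighbourhoods differ. *)
move=> B BA; have [sBA|/fintype.subsetPn[x xB xA]] := boolP (nbhd F B \subset
  nbhd F A).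
  rewrite vw //; apply: wB; rewrite finset.properEneq; apply/andP; split.
    by apply/eqP => E; apply: BA; rewrite E.
  by apply/fintype.subsetP => i iB; apply: sA; apply: fintype.subset_trans sBA;
    exact: sub_nbhd.
rewrite /wt (bigD1 x) //= mnmE (negPf xA); apply: leq_trans (leq_addr _ _).
exact: max_card.
Qed.

(** [B] is the connected component of [A] inside [C], found as a grown set of largest size: an index
    of [C] meeting it could still be added. *)
Lemma grown_maximal A C : grown A -> A \subset C ->
  exists B, [/\ grown B, A \subset B, B \subset C &
    forall i, i \in C -> i \notin B -> (F i :&: nbhd F B)%SET = finset.set0].
Proof.
move=> gA AC; pose p (B : {set I}) := [&& `[< grown B >], A \subset B & B
  \subset C].
have pA : p A by rewrite /p AC subxx !andbT; apply/asboolP.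
case: (arg_maxnP (fun B : {set I} => #|B|) pA) => B /and3P[/asboolP gB AB BC]
  Bmax.
exists B; split=> // i iC iB; apply/eqP; apply: contraT => FiB.
have := Bmax (i |: B)%SET; rewrite /geq /= cardsU1 iB ltnn; apply.
apply/and3P; split; first by apply/asboolP; exact: grownU1.
  exact: fintype.subset_trans AB (finset.subsetUr _ _).
by rewrite finset.subUset finset.sub1set iC.
Qed.

Hypothesis F_neq0 : forall i, F i != finset.set0.

(** The component of [A] among the [i] with [F i] inside [nbhd F A] contains all of them, because a
    non-empty such [F i] meets [nbhd F A]. *)
Lemma grown_saturate A : grown A -> exists B,
  [/\ grown B, saturated B, A \subset B & nbhd F B = nbhd F A].
Proof.
move=> gA; pose C := [set i | F i \subset nbhd F A]%SET.
have AC : A \subset C.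
  by apply/fintype.subsetP => i iA; rewrite finset.in_set sub_nbhd.
have [B [gB AB BC Bmax]] := grown_maximal gA AC.
have NAB : nbhd F B = nbhd F A.
  apply/eqP; rewrite finset.eqEsubset [X in _ && X]nbhdS // andbT.
  by apply/bigcupsP => i /(fintype.subsetP BC); rewrite finset.in_set.
exists B; split=> // i; rewrite NAB => iA; apply: contraT => iB.
have iC : i \in C by rewrite finset.in_set.
have := Bmax i iC iB; rewrite NAB (finset.setIidPl iA) => Fi0.
by move: (F_neq0 i); rewrite Fi0 eqxx.
Qed.

(** Induction on [#|A|]: a component [B] of [A] shares no variable with the rest, so degrees add up.
    Saturating [B] to [D] keeps the neighbourhood and can only raise the bound. *)
Lemma wt_grown_saturated k m :
    (forall A, grown A -> saturated A -> k * #|A| <= wt (nbhd F A) m)%N ->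
  forall A, (k * #|A| <= wt (nbhd F A) m)%N.
Proof.
move=> km A; have [c] := ubnP #|A|; elim: c A => // c IHc A; rewrite ltnS => Ac.
have [->|/set0Pn[i iA]] := eqVneq A finset.set0; first by rewrite cards0 muln0.
have iA1 : [set i]%SET \subset A by rewrite finset.sub1set.
have [B [gB]] := grown_maximal (grown1 i) iA1.
rewrite finset.sub1set => iB BA Bmax.
have [D [gD sD BD ND]] := grown_saturate gB.
have AB : A = (B :|: A :\: B)%SET by rewrite -[LHS](finset.setID _ B)
  (finset.setIidPr BA).
have dis : (nbhd F B :&: nbhd F (A :\: B) = finset.set0)%SET.
  apply/eqP; apply: contraT => /set0Pn[x].
  rewrite finset.in_setI => /andP[xB /finset.bigcupP[j]].
  rewrite finset.in_setD => /andP[jB jA] xj.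
  have := finset.in_set0 x; rewrite -(Bmax j jA jB) finset.in_setI xj.
  by rewrite xB.
have cAB : (#|B| + #|A :\: B| = #|A|)%N.
  by rewrite -(cardsID B A) (finset.setIidPr BA).
rewrite AB nbhdU wt_setU_disjoint // -AB -cAB mulnDr leq_add //.
  rewrite -ND; apply: leq_trans (km D gD sD).
  by rewrite leq_mul2l subset_leq_card ?orbT.
apply: IHc; have : (0 < #|B|)%N by apply/card_gt0P; exists i.
by lia.
Qed.

End Grown.

(** * Attaching a leaf to a tree *)

Section AddLeaf.
Variables (V : finType) (H : graph V) (u v : V).
Hypotheses (treeH : is_tree H) (uH : u \in vertices H) (vH : v \notin vertices
  H).

Definition add_leaf : graph V :=
  Graph (v |: vertices H)%SET ([set u; v]%SET |: edges H)%SET.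

Let graphH : is_graph H. Proof. by case: treeH. Qed.

Lemma adj_vertices x y : adj H x y -> x \in vertices H /\ y \in vertices H.
Proof.
move=> /graphH[/fintype.subsetP xyH _].
by split; apply: xyH; rewrite finset.in_set2 eqxx ?orbT.
Qed.

Lemma adj_sym (G : graph V) : ssrbool.symmetric (adj G).
Proof. by move=> x y; rewrite /adj finset.setUC. Qed.

Lemma add_leaf_adj x y : adj add_leaf x y -> x != v -> y != v -> adj H x y.
Proof.
rewrite /adj finset.in_setU1 => /predU1P[E xv yv|//].
have : v \in [set x; y]%SET by rewrite E finset.in_set2 eqxx orbT.
by rewrite finset.in_set2 eq_sym (negPf xv) eq_sym (negPf yv).
Qed.

Lemma add_leaf_adj_leaf x : adj add_leaf v x -> x = u.
Proof.
rewrite /adj finset.in_setU1 => /predU1P[E|/adj_vertices[]]; last first.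
  by rewrite (negPf vH).
have uv : u != v by apply: contraNneq vH => <-.
have : u \in [set v; x]%SET by rewrite E finset.in_set2 eqxx.
by rewrite finset.in_set2 (negPf uv) => /eqP.
Qed.

Lemma add_leaf_tree : is_tree add_leaf.
Proof.
have uv : u != v by apply: contraNneq vH => <-.
case: treeH => _ _ conH acH; split.
- move=> e /finset.setU1P[->|/graphH[eH e2]]; last first.
    by split=> //; apply: fintype.subset_trans eH (finset.subsetUr _ _).
  split; last by rewrite cards2 uv.
  rewrite finset.subUset !finset.sub1set /= !finset.in_setU1 eqxx uH.
  by rewrite orbT.
- by apply/set0Pn; exists v; rewrite finset.setU11.
- have con x : x \in vertices add_leaf -> connect (adj add_leaf) x u.
    move=> /finset.setU1P[->|xH].
      by apply: connect1; rewrite /adj finset.in_setU1 finset.setUC eqxx.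
    apply: connect_sub (conH _ _ xH uH) => y z yz; apply: connect1.
    by rewrite /adj finset.in_setU1 [_ \in edges H]yz orbT.
  move=> x y /con xu /con yu; apply: connect_trans xu _.
  by rewrite (sym_connect_sym (adj_sym _)).
move=> c c2 /andP[cyc uc].
have [vc|vc] := boolP (v \in c); last first.
  apply: (acH _ c2); rewrite /ucycle uc andbT.
  apply: (sub_in_cycle (P := [pred x | x != v]) _ _ cyc).
    by move=> x y xv yv /add_leaf_adj; exact.
  by apply/allP => x xc; apply: contraNneq vc => <-.
(* Rotated to start at [v], the cycle has distinct second and last entries; both are neighbours of
   the leaf [v], hence equal to [u], a repetition. *)
case: (rot_to vc) => i s E.
move: c2 cyc uc; rewrite -(size_rot i) -(rot_cycle i) -(rot_uniq i) E.
case/lastP: s {E} => [//|[//|x s] y] _ /=.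
rewrite rcons_path last_rcons => /and3P[/add_leaf_adj_leaf-> _].
rewrite adj_sym => /add_leaf_adj_leaf->.
by rewrite mem_rcons mem_head /= andbF.
Qed.

End AddLeaf.

(** * Maximal trees and associated primes *)

Section MaximalTrees.
Variables (K : fieldType) (n r : nat) (F : 'I_r -> {set 'I_n}).
Implicit Types (T : graph 'I_r).

Lemma subgraph_idealE T :
  subgraph_ideal F T = @monomial_prime K n (nbhd F (vertices T)).
Proof. exact: monomial_prime_bigcup. Qed.

Lemma intersection_graph_edge i j : i != j ->
  ([set i; j]%SET \in edges (intersection_graph F)) =
  ((F i :&: F j)%SET != finset.set0).
Proof.
move=> ij; apply/imsetP/idP => [[[a b] /=]|FF]; last first.
  by exists (i, j) => //; rewrite finset.inE /= ij.
rewrite finset.inE /= => /andP[ab FF] E.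
have : i \in [set a; b]%SET by rewrite -E finset.in_set2 eqxx.
have : j \in [set a; b]%SET by rewrite -E finset.in_set2 eqxx orbT.
rewrite !finset.in_set2 => /orP[]/eqP ja /orP[]/eqP ia; move: ij FF;
  rewrite ia ja ?eqxx //.
by rewrite finset.setIC.
Qed.

(** The component [B] of a vertex [i], taken inside the vertex set of [T], is closed under the edges
    of [T], since an edge leaving it would let it grow. Connectedness of [T] then makes it
    everything. *)
Lemma tree_grown T : tree_of (intersection_graph F) T -> grown F (vertices T).
Proof.
move=> [[_ eT] [gT /set0Pn[i iT] conT _]].
have iT1 : [set i]%SET \subset vertices T by rewrite finset.sub1set.
have [B [gB]] := grown_maximal (grown1 F i) iT1.
rewrite finset.sub1set => iB BT Bmax.
suff -> : vertices T = B by [].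
have cB : closed (adj T) (mem B).
  have step x y : adj T x y -> x \in B -> y \in B.
    move=> xy xB; apply: contraT => yB.
    have yT : y \in vertices T.
      have [/fintype.subsetP xyT _] := gT _ xy.
      by apply: xyT; rewrite finset.in_set2 eqxx orbT.
    have xy' : x != y by apply: contraNneq yB => <-.
    have := fintype.subsetP eT _ xy; rewrite intersection_graph_edge //.
    move=> /set0Pn[z]; rewrite finset.in_setI => /andP[zx zy].
    have := finset.in_set0 z; rewrite -(Bmax y yT yB) finset.in_setI zy.
    by rewrite (fintype.subsetP (sub_nbhd F xB) _ zx).
  by move=> x y xy; apply/idP/idP; apply: step; rewrite // adj_sym.
apply/eqP; rewrite finset.eqEsubset BT andbT; apply/fintype.subsetP => j jT.
by rewrite -(closed_connect cB (conT _ _ iT jT)).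
Qed.

Hypothesis F_neq0 : forall i, F i != finset.set0.

Lemma maximal_tree_saturated (P : set {mpoly K[n]}) T :
  maximal_tree_for F P T -> saturated F (vertices T).
Proof.
move=> [[[vT eT] treeT] PT maxT] v vN; apply: contraT => vT'.
have /set0Pn[x xv] := F_neq0 v.
(* The tree vertex [u] shares the variable [x] with [F v], so [v] can be attached there without
   changing the ideal. *)
have /finset.bigcupP[u uT xu] := fintype.subsetP vN _ xv.
have uv : u != v by apply: contraNneq vT' => <-.
have E : add_leaf T u v = T.
  apply: maxT.
  - split; last exact: add_leaf_tree.
    split; first exact: finset.subsetT.
    rewrite finset.subUset finset.sub1set intersection_graph_edge // eT andbT.
    by apply/set0Pn; exists x; rewrite finset.in_setI xu.
  - rewrite PT !subgraph_idealE /= nbhdU nbhd1; congr monomial_prime.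
    by rewrite (finset.setUidPr vN).
  - by split; exact: finset.subsetUr.
by move: vT'; rewrite -E finset.setU11.
Qed.

Lemma grown_ass A : grown F A -> saturated F A ->
  ass (transversal_ideal K F) (monomial_prime (nbhd F A)).
Proof.
move=> gA sA; split; first exact: monomial_prime_prime.
have [w wA wB] := grown_witness gA sA; exists 'X_[w].
have mX (g : {mpoly K[n]}) m : (m \in msupp (g * 'X_[w])) =
    (m \in [seq (w + m')%MM | m' <- msupp g]) by apply: perm_mem;
      exact: msuppMX.
apply/seteqP; split=> g.
  move=> /monomial_primeP gP; apply/transversal_idealP => m.
  rewrite mX => /mapP[m' /gP m'A ->] B; rewrite wtD.
  (* Only a [B] with the same neighbourhood as [A] needs the extra degree of [m']; saturation bounds
     its size by [#|A|], one more than the degree of [w]. *)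
  have [E|/eqP NB] := eqVneq (nbhd F B) (nbhd F A); last first.
    exact: leq_trans (wB B NB) (leq_addr _ _).
  rewrite E; have : (#|B| <= #|A|)%N.
    apply: subset_leq_card; apply/fintype.subsetP => i iB.
    by apply: sA; rewrite -E sub_nbhd.
  by lia.
move=> /transversal_idealP gI; apply/monomial_primeP => m mg.
(* Conversely, the condition for [A] alone forces [m] to have positive degree in [nbhd F A]. *)
have : (w + m)%MM \in msupp (g * 'X_[w]) by rewrite mX map_f.
by move=> /gI/(_ A); rewrite wtD -wA -addn1 leq_add2l.
Qed.

End MaximalTrees.

(** * The irredundant decomposition of the powers *)

Theorem corollary3p10 (K : fieldType) (n r : nat) (F : 'I_r -> {set 'I_n})
    (r_gt0 : (0 < r)%N) (F_neq0 : forall i, F i != finset.set0)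
    (l : nat) (P : 'I_l -> set {mpoly K[n]}) (P_inj : injective P)
    (assP : ass (transversal_ideal K F) = range P)
    (T : 'I_l -> graph 'I_r) (maxT : forall j, maximal_tree_for F (P j) (T j))
    (k : nat) (k_gt0 : (0 < k)%N) :
  irredundant_primary_decomposition
    (fun j => ideal_exp (P j) (k * #|vertices (T j)|))
    (ideal_exp (transversal_ideal K F) k).
Proof.
pose N j := nbhd F (vertices (T j)).
have PE j : P j = monomial_prime (N j).
  by have [_ -> _] := maxT j; exact: subgraph_idealE.
have gT j : grown F (vertices (T j)) by case: (maxT j) => /tree_grown.
have sT j : saturated F (vertices (T j)) := maximal_tree_saturated F_neq0 (maxT
  j).
have a_gt0 j : (0 < k * #|vertices (T j)|)%N.
  rewrite muln_gt0 k_gt0; have [[_ [_ T0 _ _]] _ _] := maxT j.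
  by rewrite card_gt0.
have subT A j : nbhd F A = N j -> A \subset vertices (T j).
  by move=> AN; apply/fintype.subsetP => i iA; apply: sT;
    rewrite -/(N j) -AN sub_nbhd.
split.
- by move=> j; rewrite PE; exact: monomial_prime_exp_primary.
- rewrite transversal_ideal_exp; apply/seteqP; split=> [f fI j _|f fP m mf].
    by rewrite PE monomial_prime_exp => m mf; exact: fI.
  apply: (wt_grown_saturated F_neq0) => A gA sA.
  (* The prime of a grown saturated [A] is associated, hence some [P j]; its exponent is large
     enough because [A] lies in the vertex set of [T j]. *)
  have : range P (@monomial_prime K n (nbhd F A)) by rewrite -assP;
    exact: grown_ass.
  case=> j _; rewrite PE => /monomial_prime_inj/esym NA.
  have := fP j I; rewrite PE monomial_prime_exp => /(_ m mf); rewrite -NA.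
  apply: leq_trans; rewrite leq_mul2l subset_leq_card ?orbT //; exact: subT.
- move=> i j; rewrite /= !PE !radical_monomial_prime_exp // -!PE; exact: P_inj.
(* The monomial [w *+ k] lies in every component with [i != j], but its degree in [N j] is [k] below
   the required [k * #|vertices (T j)|]. *)
move=> j; have [w wj wB] := grown_witness (gT j) (sT j).
move=> /(_ 'X_[w *+ k]); rewrite PE monomial_prime_exp => jw.
have : (k * #|vertices (T j)| <= wt (N j) (w *+ k)%MM)%N.
  apply: jw; last by rewrite msuppX mem_head.
  move=> i /= ij; rewrite PE monomial_prime_exp => m.
  rewrite msuppX mem_seq1 => /eqP->; rewrite wtMn leq_mul2l wB ?orbT // => NE.
  by move: ij; rewrite (P_inj i j) ?eqxx // !PE /N NE.
by rewrite wtMn leq_pmul2l // -wj /N ltnn.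
Qed.
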